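(* Suppose there exist an integer $\mathrm{H}_k(n;k)$, say $A$, and an $n\times n$ shiftable p.f. array $B$ (with entries in $\mathbb{Z}$) such that: (1) each row and each column of $B$ contains $h$ filled cells; (2) $supp(B)=\left[1,\frac{h}{2}(2n+1)\right]\setminus T$, where $T=\left\{(2n+1),2(2n+1),\dots,\frac{h}{2}(2n+1)\right\}$ if $k$ is even, and $T=\left\{(n+1),(n+1)+(2n+1),\dots,(n+1)+\frac{h-2}{2}(2n+1)\right\}$ if $k$ is odd; (3) the elements in every row and every column of $B$ sum to $0$; (4) $skel(A)\cap skel(B)=\emptyset$. Then there exists an integer $\mathrm{H}_{k+h}(n;k+h)$.
   Context: A partially filled (p.f.) $m\times n$ array is an $m\times n$ matrix in which some cells are allowed to be empty. Let $n,k,t$ be positive integers such that $t$ divides $2nk$, let $v=2nk+t$, and let $J$ be the subgroup of $\mathbb{Z}_v$ of order $t$. An $\mathrm{H}_t(n;k)$ (square Heffter array over $\mathbb{Z}_v$ relative to $J$) is an $n\times n$ p.f. array with elements in $\mathbb{Z}_v$ such that: each row and each column contains exactly $k$ filled cells; for every $x\in\mathbb{Z}_v\setminus J$, either $x$ or $-x$ appears in the array; the elements in every row and every column sum to $0$ in $\mathbb{Z}_v$. It is called integer if the elements in every row and every column, viewed as integers in $\pm\{1,\ldots,\lfloor\frac{2nk+t}{2}\rfloor\}$, sum to zero in $\mathbb{Z}$. For integers $a\le b$, $[a,b]=\{a,a+1,\ldots,b\}$. The support $supp(B)$ of a p.f. array $B$ with integer entries is the set of absolute values of its entries. The skeleton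 $skel(A)$ of a p.f. array $A$ is the set of its filled positions. A square p.f. array with entries in $\mathbb{Z}$ is shiftable if every row and every column contains an equal number of positive and negative entries (with every entry nonzero); in particular $h$ above is even. *)

(* Defs.v *)
From HB Require Import structures.
From mathcomp Require Import all_boot all_order all_algebra fingroup.

Set Implicit Arguments.
Unset Strict Implicit.
Unset Printing Implicit Defensive.

Import GRing.Theory.
Local Open Scope ring_scope.

(* In a partially filled array, an empty cell is [None]. *)
Notation pfarray T m n := 'M[option T]_(m, n).

Definition skel (T : Type) (m n : nat) (A : pfarray T m n) :
  {set 'I_m * 'I_n} := [set p | isSome (A p.1 p.2)].

Definition entries (T : Type) (m n : nat) (A : pfarray T m n) : seq T :=
  pmap (fun p : 'I_m * 'I_n => A p.1 p.2) (enum {: 'I_m * 'I_n}).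

Definition supp (m n : nat) (B : pfarray int m n) : seq nat :=
  [seq `|x|%N | x <- entries B].

Definition filled_per_line (T : Type) (n k : nat) (A : pfarray T n n) : Prop :=
  (forall i, #|[set j | isSome (A i j)]| = k) /\
  (forall j, #|[set i | isSome (A i j)]| = k).

Definition lines_sum0 (V : nmodType) (m n : nat) (A : pfarray V m n) : Prop :=
  (forall i, \sum_(j < n) odflt 0 (A i j) = 0) /\
  (forall j, \sum_(i < m) odflt 0 (A i j) = 0).

(* ['Z_v] is the ring of integers mod v only for 1 < v; here the positivity
   conditions in [is_heffter] give v >= 3. *)
Definition hmod (t n k : nat) : nat := (2 * n * k + t)%N.

(* The subgroup J of order t exists and is unique since t divides v. *)
Definition is_heffter (t n k : nat) (A : pfarray 'Z_(hmod t n k) n n) : Prop :=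
  [/\ [/\ (0 < n)%N, (0 < k)%N, (0 < t)%N & (t %| 2 * n * k)%N],
      filled_per_line k A,
      exists2 J : {group 'Z_(hmod t n k)}, #|J| = t &
        forall x, x \notin J -> x \in entries A \/ - x \in entries A
    & lines_sum0 A].
Arguments is_heffter : clear implicits.

(* C is A viewed in the integers.  A counting argument shows that the entries
   of a Heffter array lie outside J, hence differ from 0 and, for even v, from
   v / 2: this C exists and is unique. *)
Definition integer_view (t n k : nat) (A : pfarray 'Z_(hmod t n k) n n)
    (C : pfarray int n n) : Prop :=
  A = map_mx (omap (fun c : int => c%:~R)) C /\
  (forall c, c \in entries C -> (1 <= `|c| <= (hmod t n k) %/ 2)%N).
Arguments integer_view : clear implicits.

Definition is_integer_heffter (t n k : nat)
    (A : pfarray 'Z_(hmod t n k) n n) : Prop :=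
  is_heffter t n k A /\
  exists2 C : pfarray int n n, integer_view t n k A C & lines_sum0 C.
Arguments is_integer_heffter : clear implicits.

Definition shiftable (n : nat) (B : pfarray int n n) : Prop :=
  [/\ 0 \notin entries B,
      forall i, #|[set j | oapp (fun x : int => 0 < x) false (B i j)]|
              = #|[set j | oapp (fun x : int => x < 0) false (B i j)]|
    & forall j, #|[set i | oapp (fun x : int => 0 < x) false (B i j)]|
              = #|[set i | oapp (fun x : int => x < 0) false (B i j)]|].

Definition Tset (n k h : nat) : seq nat :=
  if odd k
  then [seq ((n + 1) + j * (2 * n + 1))%N | j <- iota 0 (h %/ 2)]
  else [seq (j * (2 * n + 1))%N | j <- iota 1 (h %/ 2)].

(* Main.v *)
(** Put [d = 2 n + 1].  The integer view of [A] covers all positive non-multiples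
    of [d] up to [s = floor (k d / 2)].  Moving every entry of [B] away from [0]
    by [s] keeps its line sums, because its lines have as many positive as
    negative entries, and carries its support onto the non-multiples of [d] in
    [s + 1, floor ((k + h) d / 2)]; superimposing the two arrays gives the
    integer Heffter array. *)
Require Import Defs.
From mathcomp Require Import all_boot all_order all_algebra.
From mathcomp Require Import fingroup cyclic zify.
Set Implicit Arguments.
Unset Strict Implicit.

Import Order.TTheory GRing.Theory FinRing.Theory Num.Theory.

Section Entries.

Lemma entriesP (T : eqType) (m n : nat) (M : pfarray T m n) (x : T) :
  reflect (exists i j, M i j = Some x) (x \in entries M).
Proof.
rewrite /entries mem_pmap; apply: (iffP mapP) => [[[i j] _ e]|[i [j e]]].
  by exists i, j.
by exists (i, j); rewrite ?mem_enum.
Qed.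

Lemma suppP (m n : nat) (M : pfarray int m n) (a : nat) :
  reflect (exists2 c, c \in entries M & absz c = a) (a \in supp M).
Proof. by apply: (iffP mapP) => -[c Mc e]; exists c. Qed.

End Entries.

Section IntegersModulo.
Local Open Scope ring_scope.

Lemma natr_Zp_eq0 (v a : nat) : (1 < v)%N ->
  (a%:R == 0 :> 'Z_v) = (v %| a)%N.
Proof. by move=> v1; rewrite -val_eqE /= val_Zp_nat. Qed.

(** If [a = - b] modulo [v], then [v] divides [a + b], which lies between [1] and [v]. Hence
    [a + b = v], and both summands equal [v / 2]. *)
Lemma natr_Zp_half_inj (v a b : nat) : (1 < v)%N ->
    (0 < a)%N -> (a <= v %/ 2)%N -> (b <= v %/ 2)%N ->
  a%:R = b%:R :> 'Z_v \/ a%:R = - b%:R :> 'Z_v -> a = b.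
Proof.
move=> v1 a0 av bv [] /eqP.
  move/eqP/(congr1 val); rewrite /= !val_Zp_nat // !modn_small //; lia.
by rewrite -addr_eq0 -natrD natr_Zp_eq0 // => /dvdnP [[|[|q]] e]; nia.
Qed.

Lemma natr_absz_Zp (v : nat) (c : int) :
  (absz c)%:R = c%:~R :> 'Z_v \/ (absz c)%:R = - c%:~R :> 'Z_v.
Proof.
case: c => m; first by left.
by right; rewrite NegzE abszN mulrNz opprK.
Qed.

Lemma Zp_natr_half (v : nat) (x : 'Z_v) : (1 < v)%N ->
  exists2 a : nat, (a <= v %/ 2)%N & x = a%:R \/ x = - a%:R.
Proof.
move=> v1; have xv : (x < v)%N by rewrite -[X in (_ < X)%N]Zp_cast.
have [xs|sx] := leqP x (v %/ 2).
  by exists x => //; left; rewrite natr_Zp.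
exists (v - x)%N; first by lia.
right; apply/eqP; rewrite -addr_eq0 -[X in X + _]natr_Zp -natrD subnKC ?(ltnW xv) //.
by rewrite natr_Zp_eq0.
Qed.

(** By Lagrange [t * a] vanishes modulo [v = t * d]; cancelling [t] leaves [d] dividing [a]. *)
Lemma dvdn_Zp_subgroup (v t d : nat) (J : {group 'Z_v}) (a : nat) :
  (1 < v)%N -> v = (t * d)%N -> #|J| = t -> a%:R \in J -> (d %| a)%N.
Proof.
move=> v1 vE Jt /expg_cardG/eqP; rewrite Jt zmodXgE -mulrnA natr_Zp_eq0 //.
by rewrite vE [(a * _)%N]mulnC dvdn_pmul2l //; case: t vE {Jt} => // vE; rewrite vE in v1.
Qed.

(** The subgroup generated by [d] serves: [1] has order [t * d], so [d] has order [t]. *)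
Lemma Zp_subgroup (v t d : nat) : (1 < v)%N -> v = (t * d)%N ->
  exists2 J : {group 'Z_v}, #|J| = t &
    forall a, (d %| a)%N -> a%:R \in J.
Proof.
move=> v1 vE; have d0 : (0 < d)%N by case: d vE => // vE; rewrite vE muln0 in v1.
have o1 : #[1%R : 'Z_v]%g = (t * d)%N by rewrite order_Zp1 Zp_cast.
exists <[(1%R : 'Z_v) ^+ d]>%G => [|a /dvdnP [q ->]].
  by rewrite -[LHS]/(#[_]%g) orderXdiv o1 ?dvdn_mull // mulnK.
by rewrite mulnC natrM mulr_natr -[d%:R]zmodXgE -zmodXgE mem_cycle.
Qed.

End IntegersModulo.

Section IntegerHeffter.
Local Open Scope ring_scope.

(** A non-multiple [a] of [2 * n + 1] is outside [J], so [A] contains [a] or [- a]. The integer [c]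
    behind that entry is congruent to [a] up to sign, and [|c|] and [a] are both at most half the
    modulus, hence equal. *)
Lemma integer_view_supp (n k : nat) (A : pfarray 'Z_(hmod k n k) n n)
    (C : pfarray int n n) :
    is_heffter k n k A -> integer_view k n k A C ->
  forall a, (0 < a <= hmod k n k %/ 2)%N -> ~~ (2 * n + 1 %| a)%N ->
  a \in supp C.
Proof.
move=> [[n0 k0 _ _] _ [J Jk covA] _] [AC leC] a /andP [a0 ale] da.
(* Since [J] has order [k], its index is [2 * n + 1], which does not depend on [k]: the excluded
   multiples are the same for [k] and [k + h]. *)
have vE : hmod k n k = (k * (2 * n + 1))%N by rewrite /hmod; lia.
have v1 : (1 < hmod k n k)%N by rewrite vE; nia.
have /covA aA : a%:R \notin J by exact: contraNN (dvdn_Zp_subgroup v1 vE Jk) da.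
have [c Cc ac] : exists2 c : int, c \in entries C &
    c%:~R = a%:R :> 'Z_(hmod k n k) \/ c%:~R = - a%:R :> 'Z_(hmod k n k).
  case: aA => /entriesP [i [j]]; rewrite AC mxE; case Cij: (C i j) => [c|] //= [e];
    by exists c; [apply/entriesP; exists i, j | auto].
apply/suppP; exists c => //; apply/esym/(@natr_Zp_half_inj (hmod k n k)) => //.
  by case/andP: (leC _ Cc).
by have [->|->] := natr_absz_Zp (hmod k n k) c; case: ac => ->;
  rewrite ?opprK; auto.
Qed.

(** A converse to the preceding lemma: it lets the new array be built and checked entirely over the
    integers. *)
Lemma supp_integer_heffter (n k : nat) (C : pfarray int n n) :
    (0 < n)%N -> (0 < k)%N -> filled_per_line k C -> lines_sum0 C ->
    (forall c, c \in entries C -> (1 <= `|c| <= hmod k n k %/ 2)%N) ->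
    (forall a, (0 < a <= hmod k n k %/ 2)%N -> ~~ (2 * n + 1 %| a)%N ->
      a \in supp C) ->
  is_integer_heffter k n k (map_mx (omap (fun c : int => c%:~R : 'Z_(hmod k n k))) C).
Proof.
move=> n0 k0 [fillr fillc] [sumr sumc] leC covC.
have vE : hmod k n k = (k * (2 * n + 1))%N by rewrite /hmod; lia.
have v1 : (1 < hmod k n k)%N by rewrite vE; nia.
split; last by exists C.
split.
- by split=> //; rewrite dvdn_mull.
- by split=> i; [rewrite -[RHS](fillr i) | rewrite -[RHS](fillc i)];
    apply: eq_card => j; rewrite !inE mxE; case: (C _ _).
- have [J Jk JE] := Zp_subgroup v1 vE.
  exists J => // x xJ; have [a ale xa] := Zp_natr_half x v1.
  have /(covC a) : (0 < a <= hmod k n k %/ 2)%N.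
    (* If [a] were [0], then [x] would be [0], which lies in [J]. *)
    rewrite ale andbT lt0n; apply: contraNneq xJ => a0.
    by case: xa => ->; rewrite ?groupV JE ?a0.
  have: ~~ (2 * n + 1 %| a)%N.
    apply: contraNN xJ => /JE aJ.
    by case: xa => -> //; rewrite -zmodVgE groupV.
  move=> da /(_ da) /suppP [c /entriesP [i [j Cij]] ca].
  have cA : c%:~R \in entries
      (map_mx (omap (fun c : int => c%:~R : 'Z_(hmod k n k))) C).
    by apply/entriesP; exists i, j; rewrite mxE Cij.
  have [e|e] := natr_absz_Zp (hmod k n k) c; move: xa; rewrite -ca e => -[] ->;
    by rewrite ?opprK; auto.
- have odfltE o : odflt 0 (omap (fun c : int => c%:~R : 'Z_(hmod k n k)) o)
      = (odflt 0 o)%:~R by case: o.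
  by split=> i; under eq_bigr do rewrite mxE odfltE;
    rewrite -rmorph_sum /= ?sumr ?sumc.
Qed.

End IntegerHeffter.

Section Overlay.
Local Open Scope ring_scope.

(** The priority given to [o] is immaterial for arrays with disjoint skeletons. *)
Definition overlay (T : Type) (o p : option T) : option T :=
  if o is Some _ then o else p.

Lemma card_overlay (I : finType) (T : Type) (f g : I -> option T) :
    (forall i, ~~ (isSome (f i) && isSome (g i))) ->
  #|[set i | isSome (overlay (f i) (g i))]|
    = (#|[set i | isSome (f i)]| + #|[set i | isSome (g i)]|)%N.
Proof.
move=> fg; rewrite -cardsUI [_ :&: _](_ : _ = set0) ?cards0 ?addn0.
  by apply: eq_card => i; rewrite !inE; case: (f i).
by apply/setP => i; rewrite !inE; apply/negbTE.
Qed.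

Lemma sum_overlay (I : finType) (V : nmodType) (f g : I -> option V) :
    (forall i, ~~ (isSome (f i) && isSome (g i))) ->
  \sum_i odflt 0 (overlay (f i) (g i))
    = \sum_i odflt 0 (f i) + \sum_i odflt 0 (g i).
Proof.
move=> fg; rewrite -big_split /=; apply: eq_bigr => i _.
by move: (fg i); case: (f i) (g i) => [x|] [y|] //= _; rewrite ?addr0 ?add0r.
Qed.

End Overlay.

Section Spread.
Local Open Scope ring_scope.

Definition spread (s : nat) (x : int) : int :=
  x + sgz x * s%:Z.

Lemma absz_spread (s : nat) (x : int) :
  x != 0 -> absz (spread s x) = (absz x + s)%N.
Proof. by rewrite /spread => x0; case: sgzP x0 => //; lia. Qed.

Lemma sum_spread (I : finType) (s : nat) (f : I -> option int) :
    #|[set i | oapp (fun x : int => 0 < x) false (f i)]|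
      = #|[set i | oapp (fun x : int => x < 0) false (f i)]| ->
  \sum_i odflt 0 (omap (spread s) (f i)) = \sum_i odflt 0 (f i).
Proof.
move=> balanced.
(* The sign is written as a difference of two indicators, so the total change is [s] times the
   number of positive entries minus the number of negative ones. *)
have spreadE i : odflt 0 (omap (spread s) (f i)) = odflt 0 (f i)
    + ((oapp (fun x : int => 0 < x) false (f i))%:R
       - (oapp (fun x : int => x < 0) false (f i))%:R) * s%:Z.
  by case: (f i) => [x|] /=; rewrite ?mul0r // /spread; case: sgzP => /= _;
    rewrite ?subrr ?subr0 ?sub0r ?mul0r.
under eq_bigr do rewrite spreadE.
rewrite big_split /= -mulr_suml sumrB -!natr_sum.
have cardE (P : pred I) : #|[set i | P i]| = (\sum_i P i)%N.
  by rewrite -sum1dep_card big_mkcond; apply: eq_bigr => i _; case: (P i).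
by rewrite !cardE in balanced; rewrite balanced subrr mul0r addr0.
Qed.

(** The first row, which exists as [n] is positive, splits into equally many positive and negative
    entries. *)
Lemma shiftable_even (n h : nat) (B : pfarray int n n) :
  (0 < n)%N -> shiftable B -> filled_per_line h B -> ~~ odd h.
Proof.
move=> n0 [B0 posneg _] [/(_ (Ordinal n0)) fill _].
pose P (o : option int) := oapp (fun x : int => 0 < x) false o.
pose N (o : option int) := oapp (fun x : int => x < 0) false o.
have := cardsUI [set j | P (B (Ordinal n0) j)] [set j | N (B (Ordinal n0) j)].
rewrite posneg -/N [_ :&: _](_ : _ = set0) ?cards0 ?addn0; last first.
  by apply/setP => j; rewrite !inE /P /N; case: (B _ _) => //= x; case: ltgtP.
rewrite [_ :|: _](_ : _ = [set j | isSome (B (Ordinal n0) j)]).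
  by rewrite fill addnn => ->; rewrite odd_double.
apply/setP => j; rewrite !inE /P /N; case Bj: (B _ j) => [x|] //=.
have: x != 0 by apply: contraNneq B0 => <-; apply/entriesP; exists (Ordinal n0), j.
by case: ltgtP.
Qed.

End Spread.

(** With [d = 2 * n + 1], half the modulus is [(k / 2) * d] for even [k], and [(k / 2) * d + n] for
    odd [k]. In the odd case the extra [n] completes the offset [n + 1] in [Tset] to [d]. *)
Lemma Tset_shift_dvdn (n k h y : nat) :
  y \in Tset n k h -> (2 * n + 1 %| y + hmod k n k %/ 2)%N.
Proof.
rewrite /Tset; case: ifPn => odd_k /mapP [j _ ->]; apply/dvdnP.
  by exists (j + (k %/ 2).+1); rewrite /hmod; nia.
by exists (j + k %/ 2); rewrite /hmod; nia.
Qed.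

Theorem theorem4p8 (n k h : nat) (A : pfarray 'Z_(hmod k n k) n n)
    (B : pfarray int n n)
    (hA : is_integer_heffter k n k A)
    (hBshift : shiftable B)
    (hBfill : filled_per_line h B)
    (hBsupp : forall x : nat, x \in supp B <->
       (1 <= x <= (h %/ 2) * (2 * n + 1)) /\ x \notin Tset n k h)
    (hBsum : lines_sum0 B)
    (hskel : skel A :&: skel B = set0) :
  exists A' : pfarray 'Z_(hmod (k + h) n (k + h)) n n,
    is_integer_heffter (k + h) n (k + h) A'.
Proof.
case: hA => heffA [C CA [sumr sumc]].
have coverC := integer_view_supp heffA CA.
case: heffA CA => [[n0 k0 _ _] [fillr fillc] _ _] [AC leC].
have even_h := shiftable_even n0 hBshift hBfill.
case: hBshift hBfill hBsum => [B0 posnegr posnegc] [Bfillr Bfillc] [Bsumr Bsumc].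
pose s := hmod k n k %/ 2.
(* As [h] is even, the added [h * (2 * n + 1)] is halved exactly, without disturbing the floor in
   [s]. *)
have sE : hmod (k + h) n (k + h) %/ 2 = (s + (h %/ 2) * (2 * n + 1))%N.
  by rewrite /s /hmod; nia.
have AisC i j : isSome (A i j) = isSome (C i j).
  by rewrite AC mxE; case: (C i j).
have spreadB i j : isSome (omap (spread s) (B i j)) = isSome (B i j).
  by case: (B i j).
have disj i j : ~~ (isSome (C i j) && isSome (omap (spread s) (B i j))).
  by move/setP/(_ (i, j)): hskel; rewrite !inE AisC spreadB => ->.
pose C' : pfarray int n n :=
  (\matrix_(i, j) overlay (C i j) (omap (spread s) (B i j)))%R.
have entriesC' c : c \in entries C' <->
    c \in entries C \/ exists2 b, b \in entries B & c = spread s b.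
  split=> [/entriesP [i [j]]|].
    rewrite mxE; case Cij: (C i j) => [x|] /=.
      by case=> <-; left; apply/entriesP; exists i, j.
    case Bij: (B i j) => [b|] //= [<-]; right; exists b => //.
    by apply/entriesP; exists i, j.
  case=> [/entriesP [i [j Cij]]|[b /entriesP [i [j Bij]] ->]]; apply/entriesP.
    by exists i, j; rewrite mxE Cij.
  (* Disjointness makes [C] empty at this cell, so the overlay shows the spread entry. *)
  exists i, j; move: (disj i j); rewrite mxE Bij.
  by case: (C i j) => [x|].
have absz_spreadB b : b \in entries B -> absz (spread s b) = absz b + s.
  by move=> Bb; apply: absz_spread; apply: contraNneq B0 => <-.
exists (map_mx (omap (fun c : int => c%:~R%R)) C').
apply: supp_integer_heffter => //; first by rewrite addn_gt0 k0.
- split=> i.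
    under eq_finset do rewrite mxE.
    rewrite card_overlay //; under [X in #|pred_of_set X|]eq_finset do rewrite -AisC.
    under [X in _ + #|pred_of_set X|]eq_finset do rewrite spreadB.
    by rewrite fillr Bfillr.
  under eq_finset do rewrite mxE.
  rewrite card_overlay //; under [X in #|pred_of_set X|]eq_finset do rewrite -AisC.
  under [X in _ + #|pred_of_set X|]eq_finset do rewrite spreadB.
  by rewrite fillc Bfillc.
- split=> i; under eq_bigr do rewrite mxE; rewrite sum_overlay // sum_spread //.
    by rewrite sumr Bsumr addr0.
  by rewrite sumc Bsumc addr0.
- move=> c /entriesC' [/leC|[b Bb ->]].
    by rewrite sE -/s; lia.
  have /hBsupp : absz b \in supp B by apply/suppP; exists b.
  by have := absz_spreadB b Bb; rewrite sE; lia.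
- move=> a; rewrite sE => /andP [a0 ale] da; have [as_|sa] := leqP a s.
    have /suppP [c Cc ca] : a \in supp C by rewrite coverC // a0.
    by apply/suppP; exists c => //; apply/entriesC'; left.
  (* Values above [s] come from [B]: if [a - s] were in [Tset], then [a] would be a multiple of
     [2 * n + 1]. *)
  have /hBsupp/suppP [b Bb ba] : (1 <= a - s <= h %/ 2 * (2 * n + 1))
      /\ a - s \notin Tset n k h.
    split; first by lia.
    by apply: contraNN da => /Tset_shift_dvdn; rewrite -/s subnK // ltnW.
  apply/suppP; exists (spread s b); first by apply/entriesC'; right; exists b.
  by rewrite absz_spreadB // ba subnK // ltnW.
Qed.
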